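(* Let $\mathsf{X}$ be a strong nominal set, $x\in|\mathsf{X}|$, and $\pi,\gamma_1,\ldots,\gamma_n\in\mathrm{Perm}(\mathbb{A})$. If $\gamma_i\cdot x = x$ for every $i=1,\ldots,n$, and $\mathrm{dom}(\pi)\subseteq\bigcup_{1\le i\le n}\mathrm{dom}(\gamma_i)$, then $\pi\cdot x = x$.
   Context: Fix a countably infinite set $\mathbb{A}$ of atoms. A finite permutation is a bijection $\pi:\mathbb{A}\to\mathbb{A}$ with $\mathrm{dom}(\pi)=\{a\mid\pi(a)\neq a\}$ finite; they form the group $\mathrm{Perm}(\mathbb{A})$. A $\mathrm{Perm}(\mathbb{A})$-set is a set $|\mathsf{X}|$ with a group action of $\mathrm{Perm}(\mathbb{A})$. For $B\subseteq\mathbb{A}$, $\mathrm{Fix}(B)=\{\pi\mid\pi(b)=b\ \forall b\in B\}$. $B$ supports $x$ if $\pi\in\mathrm{Fix}(B)\Rightarrow\pi\cdot x=x$ for all $\pi$; $B$ strongly supports $x$ if $\pi\in\mathrm{Fix}(B)\Leftrightarrow\pi\cdot x=x$ for all $\pi$. A nominal set is a $\mathrm{Perm}(\mathbb{A})$-set all of whose elements have a finite support; it is strong if every element is strongly supported by some finite set. *)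

(* Defs.v *)
From HB Require Import structures.
From mathcomp Require Import all_boot.
From mathcomp Require Import boolp classical_sets functions cardinality.

Set Implicit Arguments.
Unset Strict Implicit.
Unset Printing Implicit Defensive.

Local Open Scope classical_set_scope.
Local Open Scope card_scope.

Definition countably_infinite (T : Type) : Prop := [set: T] #= [set: nat].

Definition fun_dom (A : Type) (f : A -> A) : set A := [set a | f a <> a].

Record finperm (A : Type) := FinPerm {
  finperm_fun :> A -> A;
  finperm_bij : bijective finperm_fun;
  finperm_fin : finite_set (fun_dom finperm_fun) }.

Definition dom (A : Type) (p : finperm A) : set A := fun_dom p.

Section FinPermGroup.
Variable A : Type.
Implicit Types p q r : finperm A.

HB.instance Definition _ := gen_eqMixin (finperm A).
HB.instance Definition _ := gen_choiceMixin (finperm A).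

Lemma finpermP p q : p =1 q -> p = q.
Proof.
case: p q => [f fb ff] [g gb gf] /= /funext fg; subst g.
by congr FinPerm; exact: Prop_irrelevance.
Qed.

Lemma finperm_one_fin : finite_set (fun_dom (@id A)).
Proof. by apply: (sub_finite_set _ (finite_set0 A)) => a; apply. Qed.

Definition finperm_one : finperm A :=
  FinPerm (Bijective (fun=> erefl) (fun=> erefl)) finperm_one_fin.

Lemma finperm_mul_fin p q : finite_set (fun_dom (p \o q)).
Proof.
apply: (sub_finite_set (B := dom p `|` dom q)); last first.
  by rewrite finite_setU; split; exact: finperm_fin.
move=> a /= pqa; have [qa|qa] := pselect (q a = a); last by right.
by left => pa; apply: pqa; rewrite /= qa.
Qed.

Definition finperm_mul p q : finperm A :=
  FinPerm (bij_comp (finperm_bij p) (finperm_bij q)) (finperm_mul_fin p q).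

Lemma finperm_inv_ex p : {g : A -> A | cancel p g /\ cancel g p}.
Proof. by apply: cid; case: (finperm_bij p) => g; exists g. Qed.

Definition finperm_inv_fun p : A -> A := sval (finperm_inv_ex p).

Lemma finpermK p : cancel p (finperm_inv_fun p).
Proof. exact: (svalP (finperm_inv_ex p)).1. Qed.

Lemma finpermVK p : cancel (finperm_inv_fun p) p.
Proof. exact: (svalP (finperm_inv_ex p)).2. Qed.

Lemma finperm_inv_fin p : finite_set (fun_dom (finperm_inv_fun p)).
Proof.
apply: sub_finite_set (finperm_fin p) => a /= va pa.
by apply: va; rewrite -{1}pa finpermK.
Qed.

Definition finperm_inv p : finperm A :=
  FinPerm (Bijective (finpermVK p) (finpermK p)) (finperm_inv_fin p).

Lemma finperm_mulA : associative finperm_mul.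
Proof. by move=> p q r; exact: finpermP. Qed.

Lemma finperm_mul1 : left_id finperm_one finperm_mul.
Proof. by move=> p; exact: finpermP. Qed.

Lemma finperm_mulr1 : right_id finperm_one finperm_mul.
Proof. by move=> p; exact: finpermP. Qed.

Lemma finperm_mulV : left_inverse finperm_one finperm_inv finperm_mul.
Proof. by move=> p; apply: finpermP => a /=; exact: finpermK. Qed.

Lemma finperm_mulrV : right_inverse finperm_one finperm_inv finperm_mul.
Proof. by move=> p; apply: finpermP => a /=; exact: finpermVK. Qed.

HB.instance Definition _ := isGroup.Build (finperm A)
  finperm_mulA finperm_mul1 finperm_mulr1 finperm_mulV finperm_mulrV.

End FinPermGroup.

(* A left action: the group law of [finperm A] is [(p * q) a = p (q a)]. *)
Record permSet (A : Type) := PermSet {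
  permSet_carrier :> Type;
  permact : finperm A -> permSet_carrier -> permSet_carrier;
  permact1 : forall x, permact 1%g x = x;
  permactM : forall p q x, permact (p * q)%g x = permact p (permact q x) }.

Definition Fix (A : Type) (B : set A) : set (finperm A) :=
  [set p | forall b, B b -> p b = b].

Definition supports (A : Type) (X : permSet A) (B : set A) (x : X) : Prop :=
  forall p : finperm A, Fix B p -> permact p x = x.

Definition strongly_supports (A : Type) (X : permSet A) (B : set A) (x : X) :
    Prop :=
  forall p : finperm A, Fix B p <-> permact p x = x.

Record nominalSet (A : Type) := NominalSet {
  nominalSet_permSet :> permSet A;
  nominal_support : forall x : nominalSet_permSet,
    exists B : set A, finite_set B /\ supports B x }.

Definition strong (A : Type) (X : nominalSet A) : Prop :=
  forall x : X, exists B : set A, finite_set B /\ strongly_supports B x.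

(* Main.v *)
Require Import Defs.
From mathcomp Require Import all_boot.
From mathcomp Require Import boolp classical_sets functions cardinality.

Local Open Scope classical_set_scope.

Theorem theorem3p4 (A : Type) (cA : countably_infinite A)
    (X : nominalSet A) (sX : strong X) (x : X)
    (n : nat) (p : finperm A) (g : 'I_n -> finperm A)
    (gx : forall i : 'I_n, permact (g i) x = x)
    (pg : dom p `<=` \bigcup_(i in [set: 'I_n]) dom (g i)) :
  permact p x = x.
Proof.
(* Strong support turns fixing [x] into fixing [B] pointwise, so the claim reduces to a check on
   single atoms of [B]. *)
have [B [_ xB]] := sX x; apply/xB => b Bb.
(* An atom of [B] moved by [p] would be moved by some [g i]. *)
have [//|/pg[i _ gib]] := pselect (p b = b).
(* But [g i] fixes [x], hence fixes [b]: this is the direction of strong support that plain support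
   does not give. *)
by case: gib; apply: (xB (g i)).2 (gx i) b Bb.
Qed.
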